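(* Let $n\ge 1$, let $\Sigma\in M_n\otimes M_n$, and let $\sigma:M_n\to M_n$ be the linear map with $\Sigma=\mathrm{C}_\sigma=\sum_{i,j=1}^n e_{ij}\otimes\sigma(e_{ij})$. Then the following are equivalent: (i) $\Sigma$ satisfies the Choi correspondence, i.e. for every $m=1,2,\dots$ and every linear map $\phi:M_n\to M_m$, $\phi$ is completely positive if and only if $\mathrm{C}^\Sigma_\phi=(\mathrm{id}_n\otimes\phi)(\Sigma)\in M_n\otimes M_m$ is positive semi-definite; (ii) for every $m=1,2,\dots$ and every linear map $\phi:M_n\to M_m$, $\phi\in\mathbb{CP}[M_n,M_m]$ if and only if $\phi\circ\sigma\in\mathbb{CP}[M_n,M_m]$; (iii) $\mathbb{CP}[M_m,M_n]=\{\sigma\circ\tau:\tau\in\mathbb{CP}[M_m,M_n]\}$ for every $m=1,2,\dots$; (iv) $\sigma$ is a complete order isomorphism; (v) $\sigma=\mathrm{Ad}_s$ for some nonsingular matrix $s\in M_n$; (vi) $\Sigma$ is a positive semi-definite rank one matrix whose range vector in $\mathbb C^n\otimes\mathbb C^n$ has full Schmidt rank $n$; (vii) for any basis $\{|\xi_i\rangle\}_{i=1}^n$ of $\mathbb C^n$, there exists a basis $\{|\eta_i\rangle\}_{i=1}^n$ of $\mathbb C^n$ such that $\Sigma=\sum_{i,j=1}^n|\xi_i\rangle\langle\xi_j|\otimes|\eta_i\rangle\langle\eta_j|$; (viii) $\Sigma=\sum_{i,j=1}^n|\xi_i\rangle\langle\xi_j|\otimes|\eta_i\rangle\langle\eta_j|$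 for some bases $\{|\xi_i\rangle\}_{i=1}^n$ and $\{|\eta_i\rangle\}_{i=1}^n$ of $\mathbb C^n$.
   Context: $M_n$ is the algebra of $n\times n$ complex matrices, with standard matrix units $\{e_{ij}\}$; $M_n\otimes M_m$ is identified with $M_{nm}$, acting on $\mathbb C^n\otimes\mathbb C^m$. ''Positive'' for matrices means positive semi-definite. For a linear map $\phi:M_n\to M_m$, its Choi matrix is $\mathrm{C}_\phi=\sum_{i,j=1}^n e_{ij}\otimes\phi(e_{ij})\in M_n\otimes M_m$; the assignment $\phi\mapsto\mathrm{C}_\phi$ is a linear isomorphism from linear maps $M_n\to M_m$ onto $M_n\otimes M_m$. For $\Sigma\in M_n\otimes M_n$ define $\mathrm{C}^\Sigma_\phi=(\mathrm{id}_n\otimes\phi)(\Sigma)\in M_n\otimes M_m$, where $\mathrm{id}_n$ is the identity map on $M_n$. $\mathbb{CP}[M_n,M_m]$ denotes the convex cone of all completely positive linear maps from $M_n$ into $M_m$. A linear map $\sigma:M_n\to M_n$ is a complete order isomorphism if it is a bijection and both $\sigma$ and $\sigma^{-1}$ are completely positive. For $s\in M_n$, $\mathrm{Ad}_s:M_n\to M_n$ is $\mathrm{Ad}_s(x)=s^*xs$. The range vector of a positive rank one matrix is a vector spanning its range (determined up to a nonzero scalar). The Schmidt rank of a vector $v\in\mathbb C^n\otimes\mathbb C^n$ is the least $k$ such that $v$ is a sum of $k$ product vectors $x\otimes y$; it is full if it equals $n$. $|\xi\rangle\langle\xi'|$ denotes the rank one matrix $\xi\,\xi'^{*}$ for column vectors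 $\xi,\xi'\in\mathbb C^n$. *)

(* Defs.v *)
From HB Require Import structures.
From mathcomp Require Import all_boot all_order all_algebra.
From mathcomp Require Import mxtens complex.
From mathcomp Require Import boolp classical_sets reals.

Set Implicit Arguments.
Unset Strict Implicit.
Unset Printing Implicit Defensive.

Import Order.TTheory GRing.Theory Num.Theory.
Local Open Scope classical_set_scope.
Local Open Scope ring_scope.

(* Everything is set up over an arbitrary [numClosedFieldType]; the field of
   complex numbers is the instance [R[i]] with [R : realType].
   [M_n (x) M_m] is ['M_(n * m)], with the Kronecker product [*t] of mxtens. *)
Section Definitions.
Variable C : numClosedFieldType.

Definition ctrmx (p q : nat) (A : 'M[C]_(p, q)) : 'M[C]_(q, p) :=
  map_mx Num.conj A^T.

Definition psdmx (p : nat) (A : 'M[C]_p) : Prop :=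
  ctrmx A = A /\ forall x : 'cV[C]_p, 0 <= (ctrmx x *m A *m x) 0 0.

(* The matrix [X_ij] of [X = \sum_(i, j) delta_mx i j *t X_ij]. *)
Definition tblock (k p : nat) (X : 'M[C]_(k * p)) (i j : 'I_k) : 'M[C]_p :=
  \matrix_(a, b) X (mxtens_index (i, a)) (mxtens_index (j, b)).

(* The map [id_k (x) phi]; see [idtens_tens] for its values on [A *t B]. *)
Definition idtens (k p q : nat) (phi : 'M[C]_p -> 'M[C]_q)
    (X : 'M[C]_(k * p)) : 'M[C]_(k * q) :=
  \sum_(i < k) \sum_(j < k) delta_mx i j *t phi (tblock X i j).

Definition completely_positive (p q : nat) (phi : 'M[C]_p -> 'M[C]_q) : Prop :=
  forall (k : nat) (X : 'M[C]_(k * p)), psdmx X -> psdmx (idtens phi X).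

Definition CP (p q : nat) : set ('M[C]_p -> 'M[C]_q) :=
  [set phi | linear phi /\ completely_positive phi].

Definition choi (p q : nat) (phi : 'M[C]_p -> 'M[C]_q) : 'M[C]_(p * q) :=
  \sum_(i < p) \sum_(j < p) delta_mx i j *t phi (delta_mx i j).

(* [C^Sigma_phi] *)
Definition choi_by (n m : nat) (Sigma : 'M[C]_(n * n))
    (phi : 'M[C]_n -> 'M[C]_m) : 'M[C]_(n * m) :=
  idtens phi Sigma.

Definition choi_correspondence (n : nat) (Sigma : 'M[C]_(n * n)) : Prop :=
  forall m : nat, (0 < m)%N -> forall phi : {linear 'M[C]_n -> 'M[C]_m},
    completely_positive phi <-> psdmx (choi_by Sigma phi).

Definition complete_order_iso (n : nat) (f : 'M[C]_n -> 'M[C]_n) : Prop :=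
  exists g : 'M[C]_n -> 'M[C]_n,
    [/\ cancel f g, cancel g f, completely_positive f & completely_positive g].

Definition Ad (n : nat) (s : 'M[C]_n) (x : 'M[C]_n) : 'M[C]_n :=
  ctrmx s *m x *m s.

Definition tensv (p q : nat) (x : 'cV[C]_p) (y : 'cV[C]_q) : 'cV[C]_(p * q) :=
  x *t y.

Definition sum_of_products (p q : nat) (v : 'cV[C]_(p * q)) (k : nat) : Prop :=
  exists (x : 'I_k -> 'cV[C]_p) (y : 'I_k -> 'cV[C]_q),
    v = \sum_(i < k) tensv (x i) (y i).

Definition is_schmidt_rank (p q : nat) (v : 'cV[C]_(p * q)) (k : nat) : Prop :=
  sum_of_products v k /\ forall l : nat, sum_of_products v l -> (k <= l)%N.

(* The range of [A] is its column space, i.e. the row space of [A^T]. *)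
Definition spans_range (p : nat) (A : 'M[C]_p) (v : 'cV[C]_p) : Prop :=
  (v^T :=: A^T)%MS.

Definition ketbra (n : nat) (x y : 'cV[C]_n) : 'M[C]_n := x *m ctrmx y.

Definition basis_sum (n : nat) (xi eta : n.-tuple 'cV[C]_n) : 'M[C]_(n * n) :=
  \sum_(i < n) \sum_(j < n)
    ketbra (tnth xi i) (tnth xi j) *t ketbra (tnth eta i) (tnth eta j).

Lemma idtens_tens (k p q : nat) (phi : {linear 'M[C]_p -> 'M[C]_q})
    (A : 'M[C]_k) (B : 'M[C]_p) :
  idtens phi (A *t B) = A *t phi B.
Proof.
have tb i j : tblock (A *t B) i j = A i j *: B.
  by apply/matrixP => a b; rewrite !mxE !mxtens_indexK.
apply/matrixP => u v; rewrite /idtens summxE.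
case: (mxtens_indexP u) => i a; case: (mxtens_indexP v) => j b.
rewrite tensmxE (bigD1 i) //= summxE (bigD1 j) //= tensmxE tb linearZ !mxE.
rewrite !eqxx mul1r big1 => [|j' /negPf ne]; last first.
  by rewrite tensmxE !mxE (eq_sym j) ne andbF mul0r.
rewrite big1 ?addr0 // => i' /negPf ne; rewrite summxE big1 // => j' _.
by rewrite tensmxE !mxE (eq_sym i) ne mul0r.
Qed.

End Definitions.
Arguments CP : clear implicits.

(* Main.v *)
Require Import Defs.
From HB Require Import structures.
From mathcomp Require Import all_boot all_order all_algebra.
From mathcomp Require Import mxtens complex.
From mathcomp Require Import boolp classical_sets reals.

(* Throughout, [Sigma = C_sigma] and [C^Sigma_phi = C_(phi \o sigma)], so Choi's
   theorem turns (i) into (ii).  Under (ii), sigma is completely positive (take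
   phi = id) and onto (a functional vanishing on its range is completely positive
   together with its opposite, hence zero), so its inverse exists and is
   completely positive too.  Writing sigma and its inverse in Kraus form gives
   id = \sum_(i, j) Ad_(s_i t_j); as C_id has rank one, every s_i t_j is scalar,
   so all the s_i are multiples of one invertible matrix and sigma = Ad_s.
   Finally C_(Ad_s) = v v^* where v is the vectorization of the entrywise
   conjugate of s, so the Schmidt rank of v is the rank of s, and the expansions
   of v as \sum_i xi_i (x) eta_i are the factorizations of that matrix. *)

Set Implicit Arguments.
Unset Strict Implicit.
Unset Printing Implicit Defensive.

Import Order.TTheory GRing.Theory Num.Theory.
Local Open Scope classical_set_scope.
Local Open Scope ring_scope.

(** * Conjugate transpose, positive matrices and extremal rays *)

Section ConjugateTranspose.
Variable C : numClosedFieldType.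

Lemma ctrmxE p q (A : 'M[C]_(p, q)) i j : ctrmx A i j = (A j i)^*.
Proof. by rewrite !mxE. Qed.

Lemma ctrmxK p q : cancel (@ctrmx C p q) (@ctrmx C q p).
Proof. by move=> A; apply/matrixP => i j; rewrite !ctrmxE conjCK. Qed.

Lemma ctrmxM p q r (A : 'M[C]_(p, q)) (B : 'M[C]_(q, r)) :
  ctrmx (A *m B) = ctrmx B *m ctrmx A.
Proof. by rewrite /ctrmx trmx_mul map_mxM. Qed.

Lemma ctrmxZ p q a (A : 'M[C]_(p, q)) : ctrmx (a *: A) = a^* *: ctrmx A.
Proof. by apply/matrixP => i j; rewrite !mxE rmorphM. Qed.

Lemma ctrmxD p q (A B : 'M[C]_(p, q)) : ctrmx (A + B) = ctrmx A + ctrmx B.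
Proof. by apply/matrixP => i j; rewrite !mxE rmorphD. Qed.

Lemma ctrmx0 p q : ctrmx (0 : 'M[C]_(p, q)) = 0.
Proof. by apply/matrixP => i j; rewrite !mxE conjC0. Qed.

Lemma ctrmx1 p : ctrmx (1%:M : 'M[C]_p) = 1%:M.
Proof. by rewrite /ctrmx trmx1 map_mx1. Qed.

Lemma ctrmx_sum I (r : seq I) (P : pred I) p q (F : I -> 'M[C]_(p, q)) :
  ctrmx (\sum_(i <- r | P i) F i) = \sum_(i <- r | P i) ctrmx (F i).
Proof. exact: (big_morph _ (@ctrmxD p q) (@ctrmx0 p q)). Qed.

Lemma ctrmx_tens p q r s (A : 'M[C]_(p, q)) (B : 'M[C]_(r, s)) :
  ctrmx (A *t B) = ctrmx A *t ctrmx B.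
Proof. by rewrite /ctrmx trmx_tens map_mxT. Qed.

Lemma ctrmx_unit p (A : 'M[C]_p) : (ctrmx A \in unitmx) = (A \in unitmx).
Proof. by rewrite /ctrmx map_unitmx unitmx_tr. Qed.

Lemma sqnormE p (x : 'cV[C]_p) :
  (ctrmx x *m x) 0 0 = \sum_i `|x i 0| ^+ 2.
Proof. by rewrite mxE; apply: eq_bigr => i _; rewrite ctrmxE normCK mulrC. Qed.

Lemma sqnorm_ge0 p (x : 'cV[C]_p) : 0 <= (ctrmx x *m x) 0 0.
Proof. by rewrite sqnormE sumr_ge0 // => i _; rewrite exprn_ge0. Qed.

Lemma sqnorm_eq0 p (x : 'cV[C]_p) : ((ctrmx x *m x) 0 0 == 0) = (x == 0).
Proof.
apply/eqP/eqP => [|->]; last by rewrite mulmx0 mxE.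
rewrite sqnormE => /eqP; rewrite psumr_eq0 => [/allP x0|i _]; last first.
  by rewrite exprn_ge0.
apply/matrixP => i j; rewrite ord1 mxE; apply/eqP.
by have := x0 i (mem_index_enum _); rewrite sqrf_eq0 normr_eq0.
Qed.

Lemma psdmx_gram p q (B : 'M[C]_(p, q)) : psdmx (B *m ctrmx B).
Proof.
split=> [|x]; first by rewrite ctrmxM ctrmxK.
have -> : ctrmx x *m (B *m ctrmx B) *m x
    = ctrmx (ctrmx B *m x) *m (ctrmx B *m x).
  by rewrite ctrmxM ctrmxK !mulmxA.
exact: sqnorm_ge0.
Qed.

Lemma psdmx_congr p q (A : 'M[C]_p) (S : 'M[C]_(p, q)) :
  psdmx A -> psdmx (ctrmx S *m A *m S).
Proof.
case=> hA pA; split=> [|x]; first by rewrite !ctrmxM ctrmxK hA mulmxA.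
by have := pA (S *m x); rewrite ctrmxM !mulmxA.
Qed.

Lemma psdmx0 p : psdmx (0 : 'M[C]_p).
Proof. by split=> [|x]; rewrite ?ctrmx0 // mulmx0 mul0mx mxE. Qed.

Lemma psdmx_sum I (r : seq I) p (F : I -> 'M[C]_p) :
  (forall i, psdmx (F i)) -> psdmx (\sum_(i <- r) F i).
Proof.
move=> pF; elim/big_ind: _ => [|A B [hA pA] [hB pB]|i _]; [exact: psdmx0| |by []].
split=> [|x]; first by rewrite ctrmxD hA hB.
by rewrite mulmxDr mulmxDl mxE addr_ge0.
Qed.

(** The spectral theorem writes [A] as [P^* D P] with [D] diagonal and nonnegative; then [B] is
    [P^*] times the square root of [D]. *)
Lemma psdmxP p (A : 'M[C]_p) :
  psdmx A <-> exists B : 'M[C]_p, A = B *m ctrmx B.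
Proof.
split=> [[hA pA]|[B ->]]; last exact: psdmx_gram.
pose P := spectralmx A; pose d := spectral_diag A.
have uP : P \is unitarymx by exact: spectral_unitarymx.
have EA : A = ctrmx P *m diag_mx d *m P.
  rewrite {1}(orthomx_spectralP (A := A) _) ?invmx_unitary //.
  apply: hermitian_normalmx; apply/is_hermitianmxP.
  by rewrite expr0 scale1r -[in LHS]hA.
have PP : P *m ctrmx P = 1%:M by exact/unitarymxP.
(* The quadratic form at the [i]-th eigenvector is the [i]-th eigenvalue. *)
have d_ge0 i : 0 <= d 0 i.
  have := pA (ctrmx P *m delta_mx i 0); rewrite EA ctrmxM ctrmxK.
  rewrite !mulmxA -(mulmxA _ P) PP mulmx1 -(mulmxA _ P) PP mulmx1.
  by rewrite -colE mxE mul_mx_diag !mxE !eqxx conjC1 mul1r.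
exists (ctrmx P *m diag_mx (map_mx sqrtC d)).
rewrite ctrmxM ctrmxK EA -!mulmxA; congr (_ *m _); rewrite mulmxA.
congr (_ *m _); rewrite /ctrmx tr_diag_mx map_diag_mx.
apply/matrixP => i j; rewrite mul_diag_mx !mxE; case: eqP => [->|_]; last first.
  by rewrite !mulr0n mulr0.
rewrite !mulr1n /= geC0_conj; last by rewrite sqrtC_ge0.
by rewrite -expr2 sqrtCK.
Qed.

(** With [A = B B^*], the quadratic form of [A] at [e_j] is the squared norm of [B^* e_j]; the two
    signs force it to vanish. *)
Lemma psdmx_anti p (A : 'M[C]_p) : psdmx A -> psdmx (- A) -> A = 0.
Proof.
move=> /[dup] -[_ pA] /psdmxP[B EB] [_ pN].
suff B0 : ctrmx B = 0 by rewrite EB B0 mulmx0.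
apply/matrixP => i j; have : ctrmx B *m delta_mx j (0 : 'I_1) = 0.
  apply/eqP; rewrite -sqnorm_eq0 ctrmxM ctrmxK mulmxA.
  rewrite -(mulmxA _ B) -EB eq_le pA andbT -oppr_ge0.
  by have := pN (delta_mx j 0); rewrite mulmxN mulNmx mxE.
by rewrite -colE => /matrixP/(_ i 0); rewrite !mxE.
Qed.

(* Rank one positive matrices span extremal rays of the positive cone. *)
Lemma sum_ketbra_extremal (I : finType) p (w : I -> 'cV[C]_p) (x : 'cV[C]_p) :
  \sum_i ketbra (w i) (w i) = ketbra x x ->
  forall i, exists c, w i = c *: x.
Proof.
move=> Esum i.
(* Evaluating both sides of [Esum] at [y] gives a sum of squares equal to zero. *)
have ortho (y : 'cV[C]_p) : ctrmx y *m x = 0 -> ctrmx y *m w i = 0.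
  move=> yx0; have qE (z : 'cV[C]_p) :
      (ctrmx y *m ketbra z z *m y) 0 0 = `|(ctrmx y *m z) 0 0| ^+ 2.
    rewrite /ketbra mulmxA -mulmxA mxE big_ord1 normCK.
    by rewrite -ctrmxE ctrmxM ctrmxK.
  have : \sum_j `|(ctrmx y *m w j) 0 0| ^+ 2 == 0.
    rewrite -(eq_bigr _ (fun j _ => qE (w j))) -summxE.
    by rewrite -mulmx_suml -mulmx_sumr Esum qE yx0 mxE normr0 expr0n.
  rewrite psumr_eq0 => [/allP/(_ i (mem_index_enum _))|j _]; last first.
    by rewrite exprn_ge0.
  rewrite sqrf_eq0 normr_eq0 => /eqP y0; apply/matrixP => a b.
  by rewrite !ord1 y0 mxE.
have [x0|x_neq0] := eqVneq x 0.
  exists 0; rewrite scale0r; apply/eqP; rewrite -sqnorm_eq0.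
  by rewrite ortho ?mxE // x0 mulmx0.
pose c := (ctrmx x *m w i) 0 0 / (ctrmx x *m x) 0 0; exists c.
have xw : ctrmx x *m w i = c *: (ctrmx x *m x).
  apply/matrixP => a b; rewrite !ord1 [RHS]mxE divfK //.
  by rewrite sqnorm_eq0.
(* The part of [w i] orthogonal to [x]: by [ortho] it is also orthogonal to [w i], hence to
   itself. *)
pose y := w i - c *: x.
have xy : ctrmx x *m y = 0 by rewrite mulmxBr -scalemxAr xw subrr.
have yx : ctrmx y *m x = 0 by rewrite -(ctrmxK x) -ctrmxM xy ctrmx0.
apply/eqP; rewrite -subr_eq0 -/y -sqnorm_eq0 {2}/y mulmxBr ortho //.
by rewrite -scalemxAr yx scaler0 subr0 mxE.
Qed.

End ConjugateTranspose.

(** * Choi matrices, Kraus forms and Choi's theorem *)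

Section Choi.
Variable C : numClosedFieldType.

Lemma tens_indexP k p l q (A B : 'M[C]_(k * p, l * q)) :
  (forall i a j b, A (mxtens_index (i, a)) (mxtens_index (j, b))
                 = B (mxtens_index (i, a)) (mxtens_index (j, b))) -> A = B.
Proof.
move=> AB; apply/matrixP => u v.
by case: (mxtens_indexP u) => i a; case: (mxtens_indexP v) => j b.
Qed.

Lemma sum_delta_tensE k p q (F : 'I_k -> 'I_k -> 'M[C]_(p, q)) i a j b :
  (\sum_i' \sum_j' delta_mx i' j' *t F i' j')
    (mxtens_index (i, a)) (mxtens_index (j, b)) = F i j a b.
Proof.
rewrite summxE (bigD1 i) //= summxE (bigD1 j) //= tensmxE mxE !eqxx mul1r.
rewrite big1 => [|j' /negPf ne]; last first.
  by rewrite tensmxE mxE (eq_sym j) ne andbF mul0r.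
rewrite big1 ?addr0 // => i' /negPf ne; rewrite summxE big1 // => j' _.
by rewrite tensmxE mxE (eq_sym i) ne mul0r.
Qed.

Lemma sum_tblock k p (X : 'M[C]_(k * p)) :
  \sum_i \sum_j delta_mx i j *t tblock X i j = X.
Proof. by apply: tens_indexP => i a j b; rewrite sum_delta_tensE mxE. Qed.

Lemma tblock_sum k p (F : 'I_k -> 'I_k -> 'M[C]_p) i j :
  tblock (\sum_i' \sum_j' delta_mx i' j' *t F i' j') i j = F i j.
Proof. by apply/matrixP => a b; rewrite mxE sum_delta_tensE. Qed.

Lemma idtens_comp k p q r (phi : 'M[C]_q -> 'M[C]_r) (psi : 'M[C]_p -> 'M[C]_q)
    (X : 'M[C]_(k * p)) :
  idtens (phi \o psi) X = idtens phi (idtens psi X).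
Proof.
by apply: eq_bigr => i _; apply: eq_bigr => j _; rewrite tblock_sum.
Qed.

(** For [psi := sigma] this is [C^Sigma_phi = C_(phi \o sigma)], the link between (i) and (ii). *)
Lemma idtens_choi p q r (phi : 'M[C]_q -> 'M[C]_r) (psi : 'M[C]_p -> 'M[C]_q) :
  idtens phi (choi psi) = choi (phi \o psi).
Proof.
by apply: eq_bigr => i _; apply: eq_bigr => j _; rewrite tblock_sum.
Qed.

Lemma completely_positive_comp p q r
    (phi : 'M[C]_q -> 'M[C]_r) (psi : 'M[C]_p -> 'M[C]_q) :
  completely_positive phi -> completely_positive psi ->
  completely_positive (phi \o psi).
Proof. by move=> cphi cpsi k X pX; rewrite idtens_comp; apply/cphi/cpsi. Qed.

Lemma choi_inj p q (phi psi : {linear 'M[C]_p -> 'M[C]_q}) :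
  choi phi = choi psi -> phi =1 psi.
Proof.
move=> E X; rewrite (matrix_sum_delta X) !linear_sum.
apply: eq_bigr => i _; rewrite !linear_sum; apply: eq_bigr => j _.
rewrite !linearZ; congr (_ *: _); apply/matrixP => a b.
by rewrite -!(sum_delta_tensE (fun i j => _ (delta_mx i j))) -!/(choi _) E.
Qed.

(** Inverses arise as bare functions, whereas Choi's theorem is stated for bundled linear maps. *)
Lemma linear_bundle p q (f : 'M[C]_p -> 'M[C]_q) :
  linear f -> exists F : {linear 'M[C]_p -> 'M[C]_q}, f = F.
Proof.
move=> lf; pose m := GRing.isLinear.Build C 'M[C]_p 'M[C]_q *:%R f lf.
by exists (HB.pack f m : {linear 'M[C]_p -> 'M[C]_q}).
Qed.

(** Sends [x *m y^T] to the product vector of [x] and [y], so that Schmidt rank becomes matrix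
    rank. *)
Definition tvec p q (A : 'M[C]_(p, q)) : 'cV[C]_(p * q) :=
  \col_k A (mxtens_unindex k).1 (mxtens_unindex k).2.

Definition tmat p q (v : 'cV[C]_(p * q)) : 'M[C]_(p, q) :=
  \matrix_(i, j) v (mxtens_index (i, j)) 0.

Lemma tvecK p q : cancel (@tvec p q) (@tmat p q).
Proof. by move=> A; apply/matrixP => i j; rewrite !mxE mxtens_indexK. Qed.

Lemma tmatK p q : cancel (@tmat p q) (@tvec p q).
Proof.
by move=> v; apply/matrixP => i j; rewrite !mxE -surjective_pairing
   mxtens_unindexK ord1.
Qed.

Lemma tvecZ p q a (A : 'M[C]_(p, q)) : tvec (a *: A) = a *: tvec A.
Proof. by apply/matrixP => i j; rewrite !mxE. Qed.

Definition kraus p q (I : finType) (T : I -> 'M[C]_(p, q)) (X : 'M[C]_p) :=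
  \sum_i ctrmx (T i) *m X *m T i.

Lemma kraus_linear p q (I : finType) (T : I -> 'M[C]_(p, q)) :
  linear (kraus T).
Proof.
move=> a X Y; rewrite /kraus scaler_sumr -big_split; apply: eq_bigr => i _.
by rewrite mulmxDr mulmxDl -scalemxAr -scalemxAl.
Qed.

HB.instance Definition _ p q (I : finType) (T : I -> 'M[C]_(p, q)) :=
  GRing.isLinear.Build C 'M[C]_p 'M[C]_q *:%R (kraus T) (kraus_linear T).

(** Tensoring with the identity keeps the Kraus form, with operators [1%:M *t T i], and each term is
    a congruence. *)
Lemma kraus_CP p q (I : finType) (T : I -> 'M[C]_(p, q)) :
  CP C p q (kraus T).
Proof.
split; first exact: kraus_linear.
move=> k X pX; pose S i : 'M[C]_(k * p, k * q) := 1%:M *t T i.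
suff -> : idtens (kraus T) X = \sum_i ctrmx (S i) *m X *m S i.
  by apply: psdmx_sum => i; exact: psdmx_congr.
have SE l : ctrmx (S l) *m X *m S l
    = \sum_i \sum_j delta_mx i j *t (ctrmx (T l) *m tblock X i j *m T l).
  rewrite -{1}(sum_tblock X) mulmx_sumr mulmx_suml; apply: eq_bigr => i _.
  rewrite mulmx_sumr mulmx_suml; apply: eq_bigr => j _.
  by rewrite ctrmx_tens ctrmx1 !tensmx_mul mul1mx mulmx1.
rewrite (eq_bigr _ (fun l _ => SE l)) exchange_big; apply: eq_bigr => i _.
rewrite exchange_big; apply: eq_bigr => j _.
apply: tens_indexP => i' a j' b; rewrite tensmxE !summxE mulr_sumr.
by apply: eq_bigr => l _; rewrite tensmxE.
Qed.

(** Here [(ctrmx (T l))^T] is the entrywise conjugate of [T l]. Each Kraus term contributes one rank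
    one matrix because [delta_mx i j] is a column times a row. *)
Lemma choi_kraus p q (I : finType) (T : I -> 'M[C]_(p, q)) :
  choi (kraus T) =
  \sum_l ketbra (tvec (ctrmx (T l))^T) (tvec (ctrmx (T l))^T).
Proof.
apply: tens_indexP => i a j b; rewrite sum_delta_tensE !summxE.
apply: eq_bigr => l _; rewrite -(mul_delta_mx (0 : 'I_1)) mulmxA -colE -mulmxA.
rewrite -rowE [LHS]mxE [RHS]mxE !big_ord1 ctrmxE.
by rewrite !mxE !mxtens_indexK /= conjCK.
Qed.

(** In a factorization [choi phi = B B^*], the columns of [B], reshaped into matrices and
    conjugated, are Kraus operators. *)
Lemma choi_psd_kraus p q (phi : {linear 'M[C]_p -> 'M[C]_q}) :
  psdmx (choi phi) ->
  exists T : 'I_(p * q) -> 'M[C]_(p, q), phi =1 kraus T.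
Proof.
move=> /psdmxP[B EB]; exists (fun l => ctrmx (tmat (col l B))^T).
apply: choi_inj; rewrite choi_kraus EB; apply/matrixP => u v.
rewrite mxE summxE; apply: eq_bigr => l _; rewrite ctrmxK trmxK tmatK.
by rewrite [RHS]mxE big_ord1 !ctrmxE !mxE.
Qed.

Lemma choi_idfun p : choi (@idfun 'M[C]_p) = ketbra (tvec 1%:M) (tvec 1%:M).
Proof.
have -> : idfun = kraus (fun _ : 'I_1 => 1%:M : 'M[C]_p).
  by apply/funext => X; rewrite /kraus big_ord1 ctrmx1 mul1mx mulmx1.
by rewrite choi_kraus big_ord1 ctrmx1 trmx1.
Qed.

Lemma idfun_CP p : CP C p p idfun.
Proof. by split=> // k X; rewrite [idtens _ _]sum_tblock. Qed.

(** Choi's theorem. Forwards, complete positivity is tested on the positive matrix [choi idfun];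
    backwards, a Kraus form is used. *)
Lemma completely_positiveP p q (phi : {linear 'M[C]_p -> 'M[C]_q}) :
  completely_positive phi <-> psdmx (choi phi).
Proof.
split=> [cphi|/choi_psd_kraus[T]].
  rewrite -[phi : _ -> _]/(phi \o idfun) -idtens_choi; apply: cphi.
  by rewrite choi_idfun; exact: psdmx_gram.
by move/funext => ->; case: (kraus_CP T).
Qed.

Lemma Ad_kraus n (s : 'M[C]_n) : Ad s = kraus (fun _ : 'I_1 => s).
Proof. by apply/funext => X; rewrite /kraus big_ord1. Qed.

Lemma Ad_CP n (s : 'M[C]_n) : CP C n n (Ad s).
Proof. by rewrite Ad_kraus; exact: kraus_CP. Qed.

Lemma choi_Ad n (s : 'M[C]_n) :
  choi (Ad s) = ketbra (tvec (ctrmx s)^T) (tvec (ctrmx s)^T).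
Proof. by rewrite Ad_kraus choi_kraus big_ord1. Qed.

Lemma AdK n (s : 'M[C]_n) : s \in unitmx -> cancel (Ad s) (Ad (invmx s)).
Proof.
move=> us X; rewrite /Ad -!mulmxA mulmxV // mulmx1 mulmxA -ctrmxM mulmxV //.
by rewrite ctrmx1 mul1mx.
Qed.

Lemma AdVK n (s : 'M[C]_n) : s \in unitmx -> cancel (Ad (invmx s)) (Ad s).
Proof. by move=> us; rewrite -{2}(invmxK s); apply: AdK; rewrite unitmx_inv. Qed.

Lemma CP_comp p q r (phi : 'M[C]_q -> 'M[C]_r) (psi : 'M[C]_p -> 'M[C]_q) :
  CP C q r phi -> CP C p q psi -> CP C p r (phi \o psi).
Proof.
move=> [lphi cphi] [lpsi cpsi]; split; last exact: completely_positive_comp.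
by move=> a X Y /=; rewrite lpsi lphi.
Qed.

End Choi.

(** * Schmidt rank, bases and rank one positive matrices *)

Section SchmidtRank.
Variable C : numClosedFieldType.

(** Translates matrix factorizations into expansions by product vectors. *)
Lemma tvecM p q r (A : 'M[C]_(p, r)) (B : 'M[C]_(r, q)) :
  tvec (A *m B) = \sum_l tensv (col l A) (row l B)^T.
Proof.
apply/matrixP => u v; case: (mxtens_indexP u) => i a.
rewrite !mxE mxtens_indexK summxE; apply: eq_bigr => l _.
by rewrite !mxE !mxtens_indexK.
Qed.

Lemma sum_of_products_rank_le p q (v : 'cV[C]_(p * q)) l :
  sum_of_products v l -> (\rank (tmat v) <= l)%N.
Proof.
case=> x [y Ev]; pose X : 'M[C]_(p, l) := \matrix_(i, k) x k i 0.
pose Y : 'M[C]_(l, q) := \matrix_(k, j) y k j 0.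
suff -> : v = tvec (X *m Y).
  by rewrite tvecK (leq_trans (mxrankM_maxl _ _)) // rank_leq_col.
rewrite tvecM Ev; apply: eq_bigr => k _; congr (tensv _ _).
  by apply/matrixP => i j; rewrite !mxE ord1.
by apply/matrixP => i j; rewrite !mxE ord1.
Qed.

Lemma sum_of_products_rank p q (v : 'cV[C]_(p * q)) :
  sum_of_products v (\rank (tmat v)).
Proof.
exists (fun l => col l (col_base (tmat v))).
exists (fun l => (row l (row_base (tmat v)))^T).
by rewrite -tvecM mulmx_base tmatK.
Qed.

Lemma is_schmidt_rankP p q (v : 'cV[C]_(p * q)) k :
  is_schmidt_rank v k <-> \rank (tmat v) = k.
Proof.
split=> [[vk kmin]|<-]; last first.
  by split=> [|l]; [exact: sum_of_products_rank|exact: sum_of_products_rank_le].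
apply/eqP; rewrite eqn_leq sum_of_products_rank_le // kmin //.
exact: sum_of_products_rank.
Qed.

Lemma is_schmidt_rank_full n (v : 'cV[C]_(n * n)) :
  is_schmidt_rank v n <-> tmat v \in unitmx.
Proof.
rewrite -row_full_unit; split=> [/is_schmidt_rankP/eqP //|/eqP ?].
exact/is_schmidt_rankP.
Qed.

Definition colsmx n (xi : n.-tuple 'cV[C]_n) : 'M[C]_n :=
  \matrix_(i, k) tnth xi k i 0.

Lemma col_colsmx n (xi : n.-tuple 'cV[C]_n) k : col k (colsmx xi) = tnth xi k.
Proof. by apply/matrixP => i j; rewrite !mxE ord1. Qed.

Lemma colsmx_cols n (A : 'M[C]_n) : colsmx [tuple col k A | k < n] = A.
Proof. by apply/matrixP => i j; rewrite mxE tnth_mktuple mxE. Qed.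

(** By dimension only freeness matters, and it is the injectivity of [c |-> c *m (colsmx xi)^T]. *)
Lemma basis_colsmx n (xi : n.-tuple 'cV[C]_n) :
  basis_of fullv xi = (colsmx xi \in unitmx).
Proof.
rewrite basisEfree subvf size_tuple dimvf dim_matrix mulr1 leqnn !andbT.
have lin (c : 'rV[C]_n) :
    (\sum_(i < n) c 0 i *: xi`_i)^T = c *m (colsmx xi)^T.
  apply/matrixP => a b; rewrite !mxE summxE; apply: eq_bigr => i _.
  by rewrite !mxE !ord1 (tnth_nth 0).
rewrite -unitmx_tr -row_free_unit; apply/freeP/idP => [fr|fr k k0 i].
  apply: inj_row_free => c; rewrite -lin => /(congr1 trmx).
  by rewrite trmxK trmx0 => /fr c0; apply/matrixP => i j; rewrite ord1 c0 mxE.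
have : (\row_i k i) *m (colsmx xi)^T = 0.
  rewrite -lin -[RHS]trmx0; congr (_^T); rewrite -[RHS]k0.
  by apply: eq_bigr => j _; rewrite mxE.
move/eqP; rewrite mulmx_free_eq0 // => /eqP/matrixP/(_ 0 i).
by rewrite !mxE.
Qed.

Lemma ketbra_tensv p q (x z : 'cV[C]_p) (y w : 'cV[C]_q) :
  ketbra (tensv x y) (tensv z w) = ketbra x z *t ketbra y w.
Proof.
by have := tensmx_mul x y (ctrmx z) (ctrmx w); rewrite -ctrmx_tens.
Qed.

(** By [tvecM], [v] is the sum of the products of [xi_k] and [eta_k]; expanding [ketbra v v] gives
    the double sum. *)
Lemma basis_sum_ketbra n (xi eta : n.-tuple 'cV[C]_n) (v : 'cV[C]_(n * n)) :
  v = tvec (colsmx xi *m (colsmx eta)^T) -> basis_sum xi eta = ketbra v v.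
Proof.
move->; rewrite tvecM /ketbra ctrmx_sum mulmx_suml; apply: eq_bigr => i _.
rewrite mulmx_sumr; apply: eq_bigr => j _.
by rewrite -!tr_col !trmxK !col_colsmx -[RHS]/(ketbra _ _) ketbra_tensv.
Qed.

(** From [A = w *m r], hermitian symmetry gives [A = c *: ketbra w w], positivity gives [0 <= c],
    and [a] is [sqrtC c]. *)
Lemma psd_rank1_ketbra p (A : 'M[C]_p) (w : 'cV[C]_p) :
  psdmx A -> \rank A = 1%N -> spans_range A w ->
  exists2 a : C, a != 0 & A = ketbra (a *: w) (a *: w).
Proof.
move=> [hA pA] rA wA.
have A_neq0 : A != 0 by rewrite -mxrank_eq0 rA.
have /submxP[D ED] : (A^T <= w^T)%MS by rewrite wA.
have {ED} EA : A = w *m D^T by rewrite -[A]trmxK ED trmx_mul trmxK.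
set r := D^T in EA.
have w_neq0 : w != 0 by apply: contraNneq A_neq0 => w0; rewrite EA w0 mul0mx.
pose N := (ctrmx w *m w) 0 0.
have N_neq0 : N != 0 by rewrite sqnorm_eq0.
have ww : ctrmx w *m w = N%:M by exact: mx11_scalar.
pose c := (r *m w) 0 0 / N.
have Er : ctrmx r = c *: w.
  have : ctrmx A *m w = A *m w by rewrite hA.
  rewrite {1}EA ctrmxM -mulmxA ww EA -mulmxA [r *m w]mx11_scalar.
  rewrite !mul_mx_scalar => /(congr1 ( *:%R N^-1)).
  by rewrite !scalerA mulVf // scale1r mulrC.
have EA' : A = c *: ketbra w w by rewrite -hA EA ctrmxM Er -scalemxAl.
have c_neq0 : c != 0 by apply: contraNneq A_neq0 => c0; rewrite EA' c0 scale0r.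
have c_ge0 : 0 <= c.
  have := pA w; rewrite EA' -scalemxAr -scalemxAl /ketbra !mulmxA ww.
  rewrite mul_scalar_mx -scalemxAl ww mxE [X in c * X]mxE mxE mulr1n.
  by rewrite pmulr_lge0 // -expr2 exprn_gt0 // lt_def N_neq0 sqnorm_ge0.
exists (sqrtC c); first by rewrite sqrtC_eq0.
rewrite EA' /ketbra ctrmxZ -scalemxAr -scalemxAl scalerA geC0_conj ?sqrtC_ge0 //.
by rewrite -expr2 sqrtCK.
Qed.

End SchmidtRank.

(** * Complete order isomorphisms and the maps [Ad s] *)

Section CompleteOrderIsomorphisms.
Variable C : numClosedFieldType.

(** A surjective endomorphism of a finite-dimensional space is injective. *)
Lemma right_inverse_cancel n (f : {linear 'M[C]_n -> 'M[C]_n})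
    (g : 'M[C]_n -> 'M[C]_n) :
  cancel g f -> cancel f g.
Proof.
move=> gK; suff fI : injective f by move=> X; apply: fI; rewrite gK.
have uf : row_full (lin_mx f).
  apply/row_fullP; exists (\matrix_i mxvec (g (vec_mx (delta_mx 0 i)))).
  apply/row_matrixP => i.
  by rewrite row_mul rowK mul_vec_lin gK vec_mxK row1.
move=> X Y /(congr1 mxvec); rewrite -!mul_vec_lin => /row_free_inj E.
by apply/(can_inj mxvecK)/E; rewrite row_free_unit -row_full_unit.
Qed.

Lemma CP_iff_comp_order_iso n (sigma : {linear 'M[C]_n -> 'M[C]_n}) :
  (0 < n)%N ->
  (forall m, (0 < m)%N -> forall phi : {linear 'M[C]_n -> 'M[C]_m},
    CP C n m phi <-> CP C n m (phi \o sigma)) ->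
  complete_order_iso sigma.
Proof.
move=> n0 H; have csigma : completely_positive sigma.
  by case/(H n n0 (@idfun 'M[C]_n)): (@idfun_CP C n).
have uL : lin_mx sigma \in unitmx.
  (* A functional vanishing on the range of sigma is completely positive
     together with its opposite, hence zero. *)
  rewrite -row_full_unit -cokermx_eq0; apply/eqP/matrixP => i j.
  (* A column of the cokernel is a functional on vectorized matrices that kills the range of
     [sigma]; [phi] is this functional with values in [1 x 1] matrices. *)
  pose c := col j (cokermx (lin_mx sigma)).
  pose phi : {linear 'M[C]_n -> 'M[C]_1} := mulmxr c \o mxvec.
  have phi0 X : phi (sigma X) = 0.
    by rewrite /phi /= -mul_vec_lin /c colE -mulmxA (mulmxA (lin_mx _))
      mulmx_coker mul0mx mulmx0.
  have zeroCP : CP C n 1 (fun=> 0).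
    split=> [a X Y|k X _]; first by rewrite scaler0 addr0.
    rewrite /idtens big1 => [|i' _]; first exact: psdmx0.
    by rewrite big1 // => j' _; rewrite tensmx0.
  have [_ cphi] : CP C n 1 phi.
    by apply/H => //; rewrite (_ : _ \o _ = fun=> 0) //; apply/funext.
  have [_ cNphi] : CP C n 1 (\- phi).
    apply/(H _ _ (\- phi)) => //; rewrite (_ : _ \o _ = fun=> 0) //.
    by apply/funext => X; rewrite -[LHS]/(- phi (sigma X)) phi0 oppr0.
  have pphi := (completely_positiveP phi).1 cphi.
  have pNphi := (completely_positiveP (\- phi)).1 cNphi.
  have choi0 : choi phi = choi (\0 : 'M[C]_n -> 'M[C]_1).
    transitivity (0 : 'M[C]_(n * 1)).
      apply: psdmx_anti pphi _; rewrite (_ : - _ = choi (\- phi)) //.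
      by apply: tens_indexP => ? ? ? ?; rewrite mxE !sum_delta_tensE [RHS]mxE.
    by apply: tens_indexP => ? ? ? ?; rewrite sum_delta_tensE !mxE.
  have := choi_inj choi0 (vec_mx (delta_mx 0 i)).
  by rewrite /phi /= vec_mxK -rowE => /matrixP/(_ 0 0); rewrite !mxE.
pose g X : 'M[C]_n := vec_mx (mxvec X *m invmx (lin_mx sigma)).
have sK : cancel sigma g by move=> X; rewrite /g -mul_vec_lin mulmxK // mxvecK.
have gK : cancel g sigma.
  move=> X; apply: (can_inj mxvecK).
  by rewrite -mul_vec_lin vec_mxK mulmxKV.
exists g; split=> //; have [tau Eg] := linear_bundle (can2_linear sK gK).
suff [] : CP C n n tau by rewrite Eg.
(* As [tau \o sigma] is the identity, the hypothesis read backwards makes [tau] completely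
   positive. *)
apply/H => //; rewrite (_ : _ \o _ = idfun); first exact: idfun_CP.
by apply/funext => X /=; rewrite -Eg sK.
Qed.

Lemma order_iso_Ad n (sigma : {linear 'M[C]_n -> 'M[C]_n}) :
  (0 < n)%N -> complete_order_iso sigma ->
  exists s : 'M[C]_n, s \in unitmx /\ sigma =1 Ad s.
Proof.
move=> n0 [g [sK gK csigma cg]].
have [tau Eg] := linear_bundle (can2_linear sK gK).
rewrite Eg in sK gK cg => {g Eg}.
have [S ES] := choi_psd_kraus ((completely_positiveP _).1 csigma).
have [T ET] := choi_psd_kraus ((completely_positiveP _).1 cg).
(* [tau \o sigma] is the identity, whose Choi matrix has rank one: all the
   products [S i *m T j] are scalar. *)
pose ST (ij : 'I_(n * n) * 'I_(n * n)) := S ij.1 *m T ij.2.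
have id_kraus : idfun = kraus ST.
  apply/funext => X; rewrite /= -[LHS]sK ET ES /kraus.
  rewrite -(pair_bigA _ (fun i j =>
    ctrmx (S i *m T j) *m X *m (S i *m T j))) /= exchange_big.
  apply: eq_bigr => j _; rewrite mulmx_sumr mulmx_suml.
  by apply: eq_bigr => i _; rewrite ctrmxM !mulmxA.
have ST_scalar i j : exists c, S i *m T j = c%:M.
  have := choi_kraus ST; rewrite -id_kraus choi_idfun => /esym.
  move=> /sum_ketbra_extremal/(_ (i, j))[c].
  rewrite -tvecZ => /(can_inj (@tvecK _ _ _))/(congr1 trmx); rewrite trmxK.
  move=> /(congr1 (@ctrmx _ _ _)); rewrite ctrmxK /ST /= => ->; exists c^*.
  by rewrite linearZ /= trmx1 ctrmxZ ctrmx1 scalemx1.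
(* Otherwise [id_kraus] would send the identity matrix to zero, which [0 < n] excludes. *)
have [i0 [j0 ST_neq0]] : exists i j, S i *m T j != 0.
  apply: contrapT => ST0.
  have /matrixP/(_ (Ordinal n0) (Ordinal n0)) : (1%:M : 'M[C]_n) = 0.
    rewrite -[LHS]/(idfun _) id_kraus /kraus big1 // => -[i j] _; rewrite /ST /=.
    have /eqP -> : S i *m T j == 0; last by rewrite mulmx0.
    by apply: contrapT => /negP ?; apply: ST0; exists i, j.
  by rewrite !mxE eqxx => /eqP; rewrite oner_eq0.
have [c Ec] := ST_scalar i0 j0.
have c_neq0 : c != 0.
  by apply: contraNneq ST_neq0 => c0; rewrite Ec c0 raddf0.
have inv1 : S i0 *m (c^-1 *: T j0) = 1%:M.
  by rewrite -scalemxAr Ec scale_scalar_mx mulVf.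
have [uS _] := mulmx1_unit inv1; have inv2 := mulmx1C inv1.
have prop i : exists d, S i = d *: S i0.
  (* Multiply [S i *m T j0 = d%:M] on the right by [S i0], using that [T j0] is [c] times the
     inverse of [S i0]. *)
  have [d Ed] := ST_scalar i j0; exists (d / c).
  rewrite -[LHS]mulmx1 -inv2 mulmxA -scalemxAr Ed scale_scalar_mx.
  by rewrite mul_scalar_mx mulrC.
pose d i := projT1 (cid (prop i)).
have dE i : S i = d i *: S i0 by rewrite /d; case: cid.
(* The [i]-th Kraus term is [|d i|^2] times [Ad (S i0)], so [sigma] is [r] times [Ad (S i0)] and
   [sqrtC r] can be absorbed into the matrix. *)
pose r := \sum_i `|d i| ^+ 2.
have r_ge0 : 0 <= r by rewrite sumr_ge0 // => i _; rewrite exprn_ge0.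
have r_neq0 : r != 0.
  rewrite psumr_eq0 => [|i _]; last by rewrite exprn_ge0.
  apply/negP => /allP/(_ i0 (mem_index_enum _)).
  rewrite sqrf_eq0 normr_eq0 => /eqP d0; move: ST_neq0.
  by rewrite dE d0 scale0r mul0mx eqxx.
exists (sqrtC r *: S i0); split.
  by rewrite unitmxZ // unitfE sqrtC_eq0.
move=> X; rewrite ES /Ad ctrmxZ -!(scalemxAl, scalemxAr) scalerA.
rewrite geC0_conj ?sqrtC_ge0 // -expr2 sqrtCK /kraus scaler_suml.
apply: eq_bigr => i _; rewrite {1 2}dE ctrmxZ -!(scalemxAl, scalemxAr) scalerA.
by rewrite normCK [in RHS]mulrC.
Qed.

(** For [s] the entrywise conjugate of [tmat v], [Ad s] has the same Choi matrix as [sigma], and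
    [choi_inj] applies. *)
Lemma ketbra_Ad n (sigma : {linear 'M[C]_n -> 'M[C]_n}) (v : 'cV[C]_(n * n)) :
  choi sigma = ketbra v v -> tmat v \in unitmx ->
  exists s : 'M[C]_n, s \in unitmx /\ sigma =1 Ad s.
Proof.
move=> Es uv; exists (ctrmx (tmat v)^T); split.
  by rewrite ctrmx_unit unitmx_tr.
rewrite Ad_kraus; apply: choi_inj.
by rewrite choi_kraus big_ord1 ctrmxK trmxK tmatK.
Qed.

Lemma comp_Ad_CP n m (s : 'M[C]_n) (phi : 'M[C]_n -> 'M[C]_m) :
  s \in unitmx -> CP C n m (phi \o Ad s) <-> CP C n m phi.
Proof.
move=> us; split=> [cp|cp]; last exact: CP_comp cp (Ad_CP s).
have -> : phi = (phi \o Ad s) \o Ad (invmx s).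
  by apply/funext => X /=; rewrite AdVK.
exact: CP_comp cp (Ad_CP _).
Qed.

(** Applying [ketbra v v] to [v] multiplies it by its nonzero squared norm, so [v] lies in the
    range. *)
Lemma ketbra_rank_range p (v : 'cV[C]_p) :
  v != 0 -> \rank (ketbra v v) = 1%N /\ spans_range (ketbra v v) v.
Proof.
move=> v_neq0; have vA : (v^T :=: (ketbra v v)^T)%MS.
  apply/eqmxP; rewrite /ketbra trmx_mul submxMl andbT.
  have N_neq0 : (ctrmx v *m v) 0 0 != 0 by rewrite sqnorm_eq0.
  have E : v^T *m ((ctrmx v)^T *m v^T) = (ctrmx v *m v) 0 0 *: v^T.
    by rewrite mulmxA -trmx_mul [ctrmx v *m v]mx11_scalar tr_scalar_mx
       mul_scalar_mx !mxE mulr1n.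
  apply/submxP; exists (((ctrmx v *m v) 0 0)^-1 *: v^T).
  by rewrite -scalemxAl E scalerA mulVf // scale1r.
split=> //; rewrite -mxrank_tr -vA rank_rV.
by rewrite -trmx0 (inj_eq trmx_inj) v_neq0.
Qed.

End CompleteOrderIsomorphisms.

Theorem theorem1 (R : realType) (n : nat) (hn : (0 < n)%N)
    (Sigma : 'M[R[i]]_(n * n)) (sigma : {linear 'M[R[i]]_n -> 'M[R[i]]_n})
    (hSigma : Sigma = choi sigma) :
  [<-> (* (i) *)
       choi_correspondence Sigma;
       (* (ii) *)
       forall m : nat, (0 < m)%N ->
         forall phi : {linear 'M[R[i]]_n -> 'M[R[i]]_m},
           CP R[i] n m phi <-> CP R[i] n m (phi \o sigma);
       (* (iii) *)
       forall m : nat, (0 < m)%N ->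
         CP R[i] m n = [set sigma \o tau | tau in CP R[i] m n];
       (* (iv) *)
       complete_order_iso sigma;
       (* (v) *)
       exists s : 'M[R[i]]_n, s \in unitmx /\ sigma =1 Ad s;
       (* (vi) *)
       [/\ psdmx Sigma, \rank Sigma = 1%N &
           exists v : 'cV[R[i]]_(n * n),
             spans_range Sigma v /\ is_schmidt_rank v n];
       (* (vii) *)
       forall xi : n.-tuple 'cV[R[i]]_n, basis_of fullv xi ->
         exists eta : n.-tuple 'cV[R[i]]_n,
           basis_of fullv eta /\ Sigma = basis_sum xi eta;
       (* (viii) *)
       exists xi eta : n.-tuple 'cV[R[i]]_n,
         [/\ basis_of fullv xi, basis_of fullv eta &
             Sigma = basis_sum xi eta]].
Proof.
tfae.
- move=> H m m0 phi; have := H m m0 phi.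
  rewrite /choi_by hSigma idtens_choi => E; split=> [[_ /E psd]|[_ cp]].
    by split; [exact: linearP|exact/(completely_positiveP (phi \o sigma))].
  split; first exact: linearP.
  by apply/E; apply/(completely_positiveP (phi \o sigma)).
(* (ii) to (iii) passes through [sigma = Ad s]; composing [phi] with [Ad (invmx s)] provides
   [tau]. *)
- move=> H m m0.
  have [s [us /funext Es]] := order_iso_Ad hn (CP_iff_comp_order_iso hn H).
  rewrite Es; apply/seteqP; split=> [phi cphi|_ [tau ctau <-]]; last first.
    exact: CP_comp (Ad_CP s) ctau.
  exists (Ad (invmx s) \o phi); first exact: CP_comp (Ad_CP _) cphi.
  by apply/funext => X /=; rewrite AdVK.
(* Writing the identity as [sigma \o tau] gives a completely positive right inverse; [tau := idfun]
   shows that [sigma] is itself completely positive. *)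
- move=> H; have := idfun_CP R[i] n; rewrite {1}(H n hn) => -[tau [_ ctau] Etau].
  have tauK : cancel tau sigma.
    by move=> X; rewrite -[LHS]/((sigma \o tau) X) Etau.
  have [_ csigma] : CP R[i] n n sigma.
    by rewrite (H n hn); exists idfun => //; exact: idfun_CP.
  by exists tau; split=> //; exact: right_inverse_cancel.
- exact: order_iso_Ad.
- move=> [s [us /funext Es]]; rewrite hSigma Es choi_Ad.
  set v := tvec _.
  have uv : tmat v \in unitmx by rewrite tvecK unitmx_tr ctrmx_unit.
  (* The zero vector is an empty sum of products, so full Schmidt rank would force [n = 0]. *)
  have v_neq0 : v != 0.
    apply/eqP => v0; have /is_schmidt_rank_full[_ /(_ 0%N)] := uv.
    rewrite leqn0 => /(_ _)/eqP n0; rewrite n0 // in hn.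
    by exists (fun=> 0), (fun=> 0); rewrite big_ord0.
  have [rk span] := ketbra_rank_range v_neq0.
  split=> //; first exact: psdmx_gram.
  by exists v; split=> //; exact/is_schmidt_rank_full.
- move=> [psd rk [w [span /is_schmidt_rank_full uw]]] xi.
  rewrite basis_colsmx => uxi.
  have [a a_neq0 ES] := psd_rank1_ketbra psd rk span.
  (* Solves [colsmx xi *m E^T = a *: tmat w] for the matrix [E] whose columns are the [eta_k]. *)
  pose E := (a *: (invmx (colsmx xi) *m tmat w))^T.
  exists [tuple col k E | k < n]; rewrite basis_colsmx colsmx_cols; split.
    by rewrite unitmx_tr unitmxZ ?unitfE // unitmx_mul unitmx_inv uxi.
  rewrite ES; apply/esym/basis_sum_ketbra; rewrite colsmx_cols trmxK.
  by rewrite -scalemxAr mulKVmx // tvecZ tmatK.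
- move=> H; pose xi : n.-tuple 'cV[R[i]]_n := [tuple col k 1%:M | k < n].
  have bxi : basis_of fullv xi by rewrite basis_colsmx colsmx_cols unitmx1.
  by have [eta [beta ES]] := H xi bxi; exists xi, eta.
- move=> [xi [eta [bxi beta ES]]] m m0 phi.
  rewrite basis_colsmx in bxi; rewrite basis_colsmx in beta.
  (* The vector behind [basis_sum xi eta] has an invertible matrix, so [sigma = Ad s]; (i) then
     follows from Choi's theorem and [comp_Ad_CP]. *)
  have [||s [us /funext Es]] :=
      @ketbra_Ad _ _ sigma (tvec (colsmx xi *m (colsmx eta)^T)).
  + by rewrite -hSigma ES; exact: basis_sum_ketbra.
  + by rewrite tvecK unitmx_mul bxi unitmx_tr.
  have lphi : linear phi by exact: linearP.
  have lsphi : linear (phi \o sigma) by exact: linearP.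
  rewrite /choi_by hSigma idtens_choi.
  rewrite -(completely_positiveP (phi \o sigma)) /=.
  have [AdL AdR] := comp_Ad_CP phi us; rewrite -Es in AdL AdR.
  by split=> cp; [case: AdR|case: AdL].
Qed.
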